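(* Let $n\in\mathbb N$, let $K_1,\dots,K_n$ be singular kernel functions each satisfying (PM$_c$) for some constant $c>0$, and let $J$ be an arbitrary $n$-field function. Then the restriction $\Phi|_Y:Y\to\mathbb R^n$ of the difference function, $$\Phi(\mathbf x)=\bigl(m_1(\mathbf x)-m_0(\mathbf x),\,m_2(\mathbf x)-m_1(\mathbf x),\,\dots,\,m_n(\mathbf x)-m_{n-1}(\mathbf x)\bigr),$$ is a homeomorphism of $Y$ onto $\mathbb R^n$. Moreover, $\Phi|_Y$ is locally bi-Lipschitz.
   Context: Fix $n\in\mathbb N$. A kernel function is a function $K:(-1,0)\cup(0,1)\to\mathbb R$ that is concave on $(-1,0)$ and concave on $(0,1)$ and satisfies $\lim_{t\downarrow0}K(t)=\lim_{t\uparrow0}K(t)$. It is extended to $[-1,1]$ with values in $[-\infty,\infty)$ by setting $K(0):=\lim_{t\to0}K(t)$, $K(-1):=\lim_{t\downarrow-1}K(t)$ and $K(1):=\lim_{t\uparrow1}K(t)$; these limits exist by concavity. A kernel function is singular if $K(0)=-\infty$. For $c\ge0$, a kernel function $K$ satisfies (PM$_c$) if $K'(t)-K'(t-1)\ge c$ for almost every $t\in(0,1)$. An $n$-field function is a function $J:[0,1]\to[-\infty,\infty)$ that is bounded above and whose set of finite values $\{t:J(t)>-\infty\}$ has total weight strictly greater than $n$. Here the points $0$ and $1$ each have weight $1/2$ and every point of $(0,1)$ has weight $1$. Let $S=\{\mathbf y\in\mathbb R^n:0<y_1<\dots<y_n<1\}$ and let $\overline S$ be its closure. For kernel functions $K_1,\dots,K_n$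 and an $n$-field function $J$, put $$F(\mathbf y,t)=J(t)+\sum_{j=1}^nK_j(t-y_j),\qquad \mathbf y\in\overline S,\ t\in[0,1],$$ with the convention $a+(-\infty)=-\infty$. Set $y_0:=0$ and $y_{n+1}:=1$. For $j=0,\dots,n$ let $I_j(\mathbf y)=[y_j,y_{j+1}]$ and $m_j(\mathbf y)=\sup_{t\in I_j(\mathbf y)}F(\mathbf y,t)\in[-\infty,\infty)$. The regularity set is $Y=\{\mathbf y\in S: m_j(\mathbf y)\ne-\infty\text{ for all }j=0,\dots,n\}$. When all kernels are singular, $Y$ equals $\{\mathbf y\in S:\operatorname{rint}I_j(\mathbf y)\not\subseteq X\ \forall j\}$, where $X=\{t\in[0,1]:J(t)=-\infty\}$ and $\operatorname{rint}$ denotes the interior relative to $[0,1]$. The difference function is $\Phi(\mathbf y)=(m_1(\mathbf y)-m_0(\mathbf y),\dots,m_n(\mathbf y)-m_{n-1}(\mathbf y))$. *)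

(* Defs.v *)
From HB Require Import structures.
From mathcomp Require Import all_boot all_order all_algebra.
From mathcomp Require Import all_classical all_reals all_analysis.
Set Implicit Arguments. Unset Strict Implicit. Unset Printing Implicit Defensive.
Import Order.TTheory GRing.Theory Num.Theory.
Import numFieldNormedType.Exports.
Local Open Scope classical_set_scope.
Local Open Scope ring_scope.

Section Defs.
Variable R : realType.

Definition concave_on (f : R -> R) (a b : R) : Prop :=
  forall x y l : R, a < x < b -> a < y < b -> 0 <= l <= 1 ->
    l * f x + (1 - l) * f y <= f (l * x + (1 - l) * y).

Definition kernel_function (K : R -> R) : Prop :=
  [/\ concave_on K (-1) 0, concave_on K 0 1 &
      exists l : \bar R,
        ((K x)%:E @[x --> 0^'-] --> l) /\ ((K x)%:E @[x --> 0^'+] --> l)].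

(* extension of K to [-1,1] with values in [-oo,+oo) *)
Definition kext (K : R -> R) (s : R) : \bar R :=
  if (-1 < s < 0) || (0 < s < 1) then (K s)%:E
  else if s == 0 then lim ((K x)%:E @[x --> 0^'])
  else if s == -1 then lim ((K x)%:E @[x --> (-1)^'+])
  else lim ((K x)%:E @[x --> 1^'-]).

Definition singular_kernel (K : R -> R) : Prop :=
  kernel_function K /\ kext K 0 = -oo%E.

Definition PM (c : R) (K : R -> R) : Prop :=
  {ae (@lebesgue_measure R), forall t : R, t \in `]0, 1[ ->
     [/\ derivable K t 1, derivable K (t - 1) 1 &
         c <= derive1 K t - derive1 K (t - 1)]}.

Definition weight (t : R) : R := if (t == 0) || (t == 1) then 2^-1 else 1.

Definition n_field (n : nat) (J : R -> \bar R) : Prop :=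
  (exists M : R, forall t : R, 0 <= t <= 1 -> (J t <= M%:E)%E) /\
  exists s : seq R, [/\ uniq s,
     all (fun t => (0 <= t <= 1) && (J t != -oo%E)) s &
     n%:R < \sum_(t <- s) weight t].

(* y_j for j = 0..n+1, with y_0 = 0 and y_{n+1} = 1 *)
Definition yext (n : nat) (y : 'rV[R]_n) (j : nat) : R :=
  if j == 0%N then 0 else odflt 1 (omap (fun i : 'I_n => y ord0 i) (insub j.-1)).

Definition inS (n : nat) (y : 'rV[R]_n) : Prop :=
  forall j : nat, (j <= n)%N -> yext y j < yext y j.+1.

Definition Ffun (n : nat) (K : 'I_n -> R -> R) (J : R -> \bar R)
  (y : 'rV[R]_n) (t : R) : \bar R :=
  (J t + \sum_(j < n) kext (K j) (t - y ord0 j))%E.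

Definition mfun (n : nat) (K : 'I_n -> R -> R) (J : R -> \bar R)
  (j : nat) (y : 'rV[R]_n) : \bar R :=
  ereal_sup (Ffun K J y @` `[yext y j, yext y j.+1]).

Definition regset (n : nat) (K : 'I_n -> R -> R) (J : R -> \bar R) :
  set 'rV[R]_n :=
  [set y | inS y /\ forall j : nat, (j <= n)%N -> mfun K J j y != -oo%E].

Definition Phi (n : nat) (K : 'I_n -> R -> R) (J : R -> \bar R)
  (y : 'rV[R]_n) : 'rV[R]_n :=
  \row_(i < n) (fine (mfun K J i.+1 y) - fine (mfun K J i y)).

Definition homeo_onto (n : nat) (A : set 'rV[R]_n) (f : 'rV[R]_n -> 'rV[R]_n) : Prop :=
  {within A, continuous f} /\
  exists g : 'rV[R]_n -> 'rV[R]_n,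
    [/\ forall y, A y -> g (f y) = y,
        forall z, A (g z) /\ f (g z) = z &
        continuous g].

Definition loc_biLipschitz (n : nat) (A : set 'rV[R]_n) (f : 'rV[R]_n -> 'rV[R]_n) : Prop :=
  forall y, A y -> exists r L : R, [/\ 0 < r, 0 < L &
    forall a b, A a -> A b -> `|a - y| < r -> `|b - y| < r ->
      `|a - b| <= L * `|f a - f b| /\ `|f a - f b| <= L * `|a - b|].

End Defs.

(* Main.v *)
(* Write Y for the regularity set and Phi_k = m_(k+1) - m_k.  Exchanging the
   parameters x <= y in a sum F(x, t) + F(y, s) and using concavity on each side
   of the singularity shows that Phi_k increases when nodes other than the k-th
   move right, while (PM_c) shows that the sum m_n - m_0 of all Phi_k decreases
   at rate at least c in each node.  Thus -Phi behaves like a diagonally dominant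
   M-matrix.  As Y is closed under coordinatewise maxima, comparing x and y with
   max(x, y) gives c |x - y| <= n |Phi x - Phi y| on all of Y.  Singularity keeps
   the relevant t away from the nodes, so that Phi is locally Lipschitz and the
   sets {y in Y : B <= m_j(y) for all j} are compact; the n-field condition
   bounds max_j m_j from below on Y, so that y |-> sum_k |Phi_k(y) - z_k| attains
   its minimum there.  A minimizer with Phi_i <> z_i could be improved by moving
   its i-th node, hence Phi = z at the minimizer. *)

Require Import Defs.
From HB Require Import structures.
From mathcomp Require Import all_boot all_order all_algebra.
From mathcomp Require Import all_classical all_reals all_analysis.
From mathcomp Require Import ring lra.
Set Implicit Arguments. Unset Strict Implicit. Unset Printing Implicit Defensive.
Import Order.TTheory GRing.Theory Num.Theory.
Import numFieldNormedType.Exports.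
Local Open Scope classical_set_scope.
Local Open Scope ring_scope.

(** * Concave functions on an interval *)

Lemma concave_on_3pt (R : realType) (f : R -> R) (a b x y z : R) :
  concave_on f a b -> a < x -> x <= y -> y <= z -> z < b ->
  (z - y) * f x + (y - x) * f z <= (z - x) * f y.
Proof.
move=> cf ax xy yz zb.
have [xz|zx] := ltP x z; last first.
  have -> : y = x by lra.
  have -> : z = x by lra.
  by rewrite !subrr !mul0r addr0.
have zx0 : 0 < z - x by rewrite subr_gt0.
have zxN0 : z - x != 0 by rewrite gt_eqF.
have lE : (z - y) / (z - x) * (z - x) = z - y by rewrite mulfVK.
set l := _ / _ in lE.
have l0 : 0 <= l by apply: divr_ge0; lra.
have l1 : l <= 1 by rewrite ler_pdivrMr; lra.
have /= := cf x z l.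
have -> : l * x + (1 - l) * z = y.
  have -> : l * x + (1 - l) * z = z - l * (z - x) by ring.
  by rewrite lE; ring.
move=> /(_ ltac:(lra) ltac:(lra) ltac:(lra)) /(ler_wpM2l (ltW zx0)).
set lfx := l * f x; set u := 1 - l.
have -> : (z - x) * (lfx + u * f z) =
    (l * (z - x)) * f x + (z - x - l * (z - x)) * f z by rewrite /lfx /u; ring.
by rewrite lE; congr (_ + _ * _ <= _); ring.
Qed.

(** Since [p + q = u + v], the points [u] and [v] have complementary weights in [[p, q]], so their
    three-point inequalities add up. *)
Lemma concave_on_4pt (R : realType) (f : R -> R) (a b p u v q : R) :
  concave_on f a b -> a < p -> p <= u -> p <= v -> q < b -> p + q = u + v ->
  f p + f q <= f u + f v.
Proof.
move=> cf ap pu pv qb E.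
have := concave_on_3pt cf ap pu (ltac:(lra) : u <= q) qb.
have := concave_on_3pt cf ap pv (ltac:(lra) : v <= q) qb.
have -> : u = p + q - v by lra.
have [pq|qp] := ltP p q; last first.
  have -> : q = p by lra.
  have -> : v = p by lra.
  by rewrite addrK.
move=> H1 H2; rewrite -(ler_pM2l (x := q - p)) ?subr_gt0//; lra.
Qed.

(** On each side of the midpoint [m], [f] lies below the line through [m] and the point at distance
    [w] on the other side; [|s - m| <= 2 * w] bounds that line. *)
Lemma concave_on_bounded_above (R : realType) (f : R -> R) (a b : R) :
  concave_on f a b -> exists M, forall s, a < s -> s < b -> f s <= M.
Proof.
move=> cf; have [ab|ba] := ltP a b; last by exists 0 => s ? ?; exfalso; lra.
pose m := (a + b) / 2; pose w := (b - a) / 4.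
have w0 : 0 < w by rewrite /w; lra.
exists (f m + 2 * `|f m - f (m + w)| + 2 * `|f m - f (m - w)|) => s sa sb.
have N1 := normr_ge0 (f m - f (m + w)); have N2 := normr_ge0 (f m - f (m - w)).
have M1 := ler_norm (f m - f (m + w)); have M2 := ler_norm (f m - f (m - w)).
rewrite -(ler_pM2l w0).
have [sm|ms] := leP s m.
- have := concave_on_3pt (y := m) (z := m + w) cf sa sm.
  move=> /(_ ltac:(lra) ltac:(rewrite /m /w; lra)).
  have : (m - s) * (f m - f (m + w)) <= (2 * w) * `|f m - f (m + w)|.
    apply: (le_trans (ler_wpM2l _ M1)); first by lra.
    by apply: ler_wpM2r => //; rewrite /m /w; lra.
  have : 0 <= w * `|f m - f (m - w)| by apply: mulr_ge0; lra.
  lra.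
- have := concave_on_3pt (x := m - w) (y := m) (z := s) cf.
  move=> /(_ ltac:(rewrite /m /w; lra) ltac:(lra) (ltW ms) sb).
  have : (s - m) * (f m - f (m - w)) <= (2 * w) * `|f m - f (m - w)|.
    apply: (le_trans (ler_wpM2l _ M2)); first by lra.
    by apply: ler_wpM2r => //; rewrite /m /w; lra.
  have : 0 <= w * `|f m - f (m + w)| by apply: mulr_ge0; lra.
  lra.
Qed.

Lemma concave_on_bounded_below (R : realType) (f : R -> R) (a b p q : R) :
  concave_on f a b -> a < p -> q < b ->
  exists m, forall s, p <= s -> s <= q -> m <= f s.
Proof.
move=> cf ap qb; exists (Num.min (f p) (f q)) => s ps sq.
have [pq|qp] := ltP p q; last first.
  have -> : s = p by lra.
  by rewrite ge_min lexx.
have := concave_on_3pt cf ap ps sq qb.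
have : Num.min (f p) (f q) <= f p by rewrite ge_min lexx.
have : Num.min (f p) (f q) <= f q by rewrite ge_min lexx orbT.
set m := Num.min _ _ => mq mp H.
rewrite -(ler_pM2l (x := q - p)) ?subr_gt0//.
have : (q - s) * m <= (q - s) * f p by apply: ler_wpM2l => //; lra.
have : (s - p) * m <= (s - p) * f q by apply: ler_wpM2l => //; lra.
lra.
Qed.

(** The slope over [[u, v]] lies between those over [[p', u]] and [[v, q']], which have length at
    least [w] and over which [f] varies by at most [M - m]. *)
Lemma concave_on_lipschitz (R : realType) (f : R -> R) (a b p q : R) :
  concave_on f a b -> a < p -> q < b ->
  exists2 L, 0 <= L & forall u v, p <= u -> u <= q -> p <= v -> v <= q ->
    `|f u - f v| <= L * `|u - v|.
Proof.
move=> cf ap qb.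
have [M fM] := concave_on_bounded_above cf.
pose p' := (a + p) / 2; pose q' := (q + b) / 2.
have ap' : a < p' by rewrite /p'; lra.
have qb' : q' < b by rewrite /q'; lra.
have [m fm] := concave_on_bounded_below cf ap' qb'.
pose w := Num.min (p - p') (q' - q).
have w0 : 0 < w by rewrite lt_min /p' /q'; apply/andP; split; lra.
have [wp wq] : w <= p - p' /\ w <= q' - q by rewrite !ge_min !lexx orbT.
exists (`|M - m| / w); first by apply: divr_ge0; rewrite ?normr_ge0// ltW.
have M0 := ler_norm (M - m); have N0 := normr_ge0 (M - m).
suff key u v : p <= u -> u <= v -> v <= q ->
    `|f u - f v| <= `|M - m| / w * (v - u).
  move=> u v pu uq pv vq; have [uv|vu] := leP u v.
    by rewrite [`|u - v|]distrC [`|v - u|]ger0_norm ?subr_ge0//; apply: key.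
  rewrite distrC [`|u - v|]gtr0_norm ?subr_gt0//; apply: key => //.
  exact: ltW.
move=> pu uv vq; rewrite mulrAC ler_pdivlMr//.
have E1 := concave_on_3pt (x := p') cf ap' (ltac:(lra) : p' <= u) uv
  (ltac:(lra) : v < b).
have E2 := concave_on_3pt (z := q') cf (ltac:(lra) : a < u) uv
  (ltac:(lra) : v <= q') qb'.
have [u1 u2] : m <= f u /\ f u <= M by split; [apply: fm|apply: fM]; lra.
have [v1 v2] : m <= f v /\ f v <= M by split; [apply: fm|apply: fM]; lra.
have p1 : m <= f p' by apply: fm; lra.
have q1 : m <= f q' by apply: fm; lra.
have B0 : 0 <= `|M - m| * (v - u) by apply: mulr_ge0; lra.
have D0 := ler_norm (f u - f v).
have [le|/ltW le] := leP (f u) (f v).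
- rewrite ler0_norm ?subr_le0// opprB.
  have : (v - u) * (f u - f p') <= (v - u) * `|M - m| by apply: ler_wpM2l; lra.
  have : w * (f v - f u) <= (u - p') * (f v - f u) by apply: ler_wpM2r; lra.
  lra.
- rewrite ger0_norm ?subr_ge0//.
  have : (v - u) * (f v - f q') <= (v - u) * `|M - m| by apply: ler_wpM2l; lra.
  have : w * (f u - f v) <= (q' - v) * (f u - f v) by apply: ler_wpM2r; lra.
  lra.
Qed.

(** Difference quotients at [t] in direction [u - t] with steps in []0, 1[] are at least
    [f u - f t]; let the step tend to 0. *)
Lemma concave_on_tangent (R : realType) (f : R -> R) (a b t u : R) :
  concave_on f a b -> a < t -> t < b -> derivable f t 1 -> a < u -> u < b ->
  f u <= f t + derive1 f t * (u - t).
Proof.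
move=> cf ta tb df ua ub.
have [->|ut] := eqVneq u t; first by rewrite subrr mulr0 addr0.
have fdiff : differentiable f t by apply/derivable1_diffP.
have : derivable f t (u - t) by exact: diff_derivable.
rewrite /derivable => /cvg_ex[l Hl].
have -> : derive1 f t * (u - t) = l.
  rewrite mulrC; transitivity ('D_(u - t) f t).
    by rewrite deriveE// diff1E.
  by rewrite /derive; apply: cvg_lim.
rewrite -lerBlDl -(cvg_lim (@Rhausdorff R) (cvg_dnbhs_at_right Hl)).
apply: limr_ge; first by apply/cvg_ex; exists l; exact: cvg_dnbhs_at_right.
near=> s.
have s0 : 0 < s by near: s; exact: nbhs_right_gt.
have s1 : s < 1 by near: s; exact: nbhs_right_lt.
rewrite /= /GRing.scale /= mulrC ler_pdivlMr//.
have := cf u t s (ltac:(lra)) (ltac:(lra)) (ltac:(lra)).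
have -> : s * u + (1 - s) * t = s * (u - t) + t by ring.
lra.
Unshelve. all: by end_near.
Qed.

(** * Singular kernels and the condition (PM_c) *)

Lemma kextE (R : realType) (K : R -> R) (s : R) :
  s != 0 -> -1 < s -> s < 1 -> kext K s = (K s)%:E.
Proof.
by move=> s0 s1 s2; rewrite /kext s1 s2 /= andbT -neq_lt s0.
Qed.

(** [kext K 0] is a [lim], informative only when the limit exists; the common one-sided limit
    supplies existence. *)
Lemma singular_kernel_lt (R : realType) (K : R -> R) (B : R) :
  singular_kernel K ->
  exists2 d, 0 < d & forall s, s != 0 -> `|s| < d -> K s < B.
Proof.
case=> -[_ _ [l [Kl Kr]]]; rewrite /kext !ltxx andbF /= eqxx => K0.
have Kd : (K x)%:E @[x --> 0^'] --> l.
  move=> A lA.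
  have Al : nbhs (0 : R) [set s | s < 0 -> A (K s)%:E] := Kl A lA.
  have Ar : nbhs (0 : R) [set s | 0 < s -> A (K s)%:E] := Kr A lA.
  suff : nbhs (0 : R) [set s | s != 0 -> A (K s)%:E] by [].
  apply: filterS2 Al Ar => s /= sl sr s0.
  by move: s0 sl sr; rewrite neq_lt => /orP[s0 /(_ s0)|s0 _ /(_ s0)].
have lNy : l = -oo%E by rewrite -K0; apply/esym/cvg_lim.
move: Kd; rewrite lNy => /cvgeNyPlt/(_ B).
rewrite near_withinE => /nbhs_ballP[d /= d0 dK].
exists d => // s s0 sd; rewrite -lte_fin; apply: dK => //.
by rewrite -ball_normE /= sub0r normrN.
Qed.

Lemma PM_dense (R : realType) (c : R) (K : R -> R) (p q : R) :
  PM c K -> 0 <= p -> p < q -> q <= 1 ->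
  exists t, [/\ p < t, t < q, derivable K t 1, derivable K (t - 1) 1 &
    derive1 K (t - 1) + c <= derive1 K t].
Proof.
move=> [N [mN N0 sN]] p0 pq q1; apply: contrapT => nex.
have : (lebesgue_measure `]p, q[%classic <= (@lebesgue_measure R) N)%E.
  apply: le_measure; rewrite ?inE//.
  move=> t /=; rewrite in_itv /= => /andP[pt tq]; apply: sN => /= Ht.
  apply: nex; exists t.
  have /Ht[? ? ?] : t \in `]0, 1[ by rewrite in_itv /=; lra.
  by split => //; lra.
by rewrite N0 lebesgue_measure_itv /= lte_fin pq -EFinD lee_fin; lra.
Qed.

(* By concavity the mean slope over [t, t + h] is at least K'(q), and the mean
   slope over [t + s - 1, t + h + s - 1] is at most K'(q - 1), for any q between
   t + h and t + s. *)
Lemma PM_step (R : realType) (c : R) (K : R -> R) (t h s : R) :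
  kernel_function K -> PM c K -> 0 < t -> 0 <= h -> h < s -> t + h + s < 1 ->
  h * c + (K (t + h + s - 1) - K (t + s - 1)) <= K (t + h) - K t.
Proof.
move=> [cl cr _] pm t0 h0 hs ths.
have [q [qt qs d1 d2 qc]] :=
  @PM_dense R c K (t + h) (t + s) pm ltac:(lra) ltac:(lra) ltac:(lra).
have T1 := concave_on_tangent (u := t) cr (ltac:(lra) : 0 < q)
  (ltac:(lra) : q < 1) d1 t0 (ltac:(lra)).
have T2 := concave_on_tangent (u := t + h + s - 1) cl (ltac:(lra) : -1 < q - 1)
  (ltac:(lra) : q - 1 < 0) d2 (ltac:(lra)) (ltac:(lra)).
have S1 := concave_on_3pt (x := t) (y := t + h) (z := q) cr t0 (ltac:(lra))
  (ltac:(lra)) (ltac:(lra)).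
have S2 := concave_on_3pt (x := q - 1) (y := t + s - 1) (z := t + h + s - 1) cl
  (ltac:(lra)) (ltac:(lra)) (ltac:(lra)) (ltac:(lra)).
set D1 := derive1 K q in qc T1; set D2 := derive1 K (q - 1) in qc T2.
have R1 : h * D1 <= K (t + h) - K t.
  rewrite -(ler_pM2l (x := q - t)); last by lra.
  have := ler_wpM2l h0 T1; lra.
have R2 : K (t + h + s - 1) - K (t + s - 1) <= h * D2.
  rewrite -(ler_pM2l (x := t + h + s - q)); last by lra.
  have := ler_wpM2l h0 T2; lra.
have := ler_wpM2l h0 qc; lra.
Qed.

(* The gap [s] leaves room for the points q at which K is differentiable, so that
   [PM_step] can be summed over a uniform subdivision with steps shorter than
   [s]. *)
Lemma PM_shift (R : realType) (c : R) (K : R -> R) (a b s : R) :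
  kernel_function K -> PM c K -> 0 < a -> a <= b -> 0 < s -> b + s < 1 ->
  (b - a) * c + (K (b + s - 1) - K (a + s - 1)) <= K b - K a.
Proof.
move=> kK pm a0 ab s0 bs.
have [N Ns] : exists N : nat, b - a < N.+1%:R * s.
  exists (Num.truncn ((b - a) / s)).
  by rewrite -ltr_pdivrMr//; apply: truncnS_gt; apply: divr_ge0; lra.
pose h := (b - a) / N.+1%:R.
have N0 : 0 < N.+1%:R :> R by rewrite ltr0n.
have Nh : N.+1%:R * h = b - a by rewrite mulrC divfK// gt_eqF.
have h0 : 0 <= h by apply: divr_ge0; lra.
have hs : h < s by rewrite ltr_pdivrMr// mulrC.
have key k : (k <= N.+1)%N ->
    k%:R * h * c + (K (a + k%:R * h + s - 1) - K (a + s - 1))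
    <= K (a + k%:R * h) - K a.
  elim: k => [|k IH] kN; first by rewrite !mul0r !addr0 !subrr addr0.
  have kS : k.+1%:R * h = k%:R * h + h by rewrite -natr1 mulrDl mul1r.
  have kh : k%:R * h + h <= b - a.
    by rewrite -Nh -kS; apply: ler_wpM2r => //; rewrite ler_nat.
  have kh0 : 0 <= k%:R * h by apply: mulr_ge0.
  have := IH (ltnW kN).
  have := @PM_step _ c K (a + k%:R * h) h s kK pm ltac:(lra) h0 hs ltac:(lra).
  rewrite kS (addrA a); lra.
by have := key _ (leqnn _); rewrite Nh (addrC a (b - a)) subrK.
Qed.

(** The gap in [PM_shift] is sent to 0: [K] is Lipschitz on an interval reaching past [b - 1], so
    the two shifts by [s] cost at most [e]. *)
Lemma PM_le (R : realType) (c : R) (K : R -> R) (a b : R) :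
  kernel_function K -> PM c K -> 0 < a -> a <= b -> b < 1 ->
  (b - a) * c + (K (b - 1) - K (a - 1)) <= K b - K a.
Proof.
move=> kK pm a0 ab b1; have [cl _ _] := kK.
have [L L0 KL] := @concave_on_lipschitz R K (-1) 0 (a - 1) ((b - 1) / 2) cl
  ltac:(lra) ltac:(lra).
apply/ler_addgt0Pr => e e0.
pose s := Num.min ((1 - b) / 2) (e / (2 * L + 1)).
have L1 : 0 < 2 * L + 1 by lra.
have s0 : 0 < s by rewrite lt_min !divr_gt0// subr_gt0.
have sb : s <= (1 - b) / 2 by rewrite ge_min lexx.
have se : 2 * (L * s) <= e.
  have : s <= e / (2 * L + 1) by rewrite ge_min lexx orbT.
  rewrite ler_pdivlMr//; lra.
have := @PM_shift _ c K a b s kK pm a0 ab s0 ltac:(lra).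
have := KL (a + s - 1) (a - 1) ltac:(lra) ltac:(lra) ltac:(lra) ltac:(lra).
have := KL (b + s - 1) (b - 1) ltac:(lra) ltac:(lra) ltac:(lra) ltac:(lra).
have -> : a + s - 1 - (a - 1) = s by ring.
have -> : b + s - 1 - (b - 1) = s by ring.
rewrite (gtr0_norm s0) !ler_norml => /andP[? ?] /andP[? ?]; lra.
Qed.

(* Since t <= s + 1, concavity moves the increment of K over [t - y, t - x] to
   [s + 1 - y, s + 1 - x], where (PM_c) compares it with the increment over
   [s - y, s - x]. *)
Lemma kernel_swap (R : realType) (c : R) (K : R -> R) (x y s t : R) :
  kernel_function K -> PM c K -> 0 < x -> x <= y -> y < 1 ->
  0 <= s -> s < x -> y < t -> t <= 1 ->
  K (s - x) + K (t - y) + c * (y - x) <= K (s - y) + K (t - x).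
Proof.
move=> kK pm x0 xy y1 s0 sx yt t1; have [_ cr _] := kK.
have := @PM_le _ c K (s + 1 - y) (s + 1 - x) kK pm
  ltac:(lra) ltac:(lra) ltac:(lra).
have -> : s + 1 - x - 1 = s - x by ring.
have -> : s + 1 - y - 1 = s - y by ring.
have := @concave_on_4pt _ K 0 1 (t - y) (t - x) (s + 1 - y) (s + 1 - x) cr
  ltac:(lra) ltac:(lra) ltac:(lra) ltac:(lra) ltac:(lra).
lra.
Qed.

Lemma kernel_bounded_above (R : realType) (K : R -> R) :
  kernel_function K ->
  exists M, forall s, s != 0 -> -1 < s -> s < 1 -> K s <= M.
Proof.
case=> cl cr _; have [M1 H1] := concave_on_bounded_above cl.
have [M2 H2] := concave_on_bounded_above cr.
exists (Num.max M1 M2) => s; rewrite neq_lt le_max.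
by move=> /orP[s0|s0] s1 s2; [rewrite H1|rewrite H2 ?orbT].
Qed.

(** * Uniform constants over finite index sets, row vectors and ordered nodes *)

Lemma ord_uniform_ge (R : realType) (n : nat) (P : 'I_n -> R -> Prop) :
  (forall k x x', x <= x' -> P k x -> P k x') -> (forall k, exists x, P k x) ->
  exists2 x, 0 <= x & forall k, P k x.
Proof.
move=> mono /choice[f Pf]; exists (\big[Num.max/0]_(k < n) f k).
  exact: bigmax_ge_id.
by move=> k; apply: mono (Pf k); exact: le_bigmax.
Qed.

Lemma ord_uniform_pos (R : realType) (n : nat) (P : 'I_n -> R -> Prop) :
  (forall k x x', x' <= x -> P k x -> P k x') ->
  (forall k, exists2 x, 0 < x & P k x) ->
  exists2 x, 0 < x & forall k, P k x.
Proof.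
move=> mono H.
have /choice[f Pf] k : exists x, 0 < x /\ P k x.
  by have [x x0 Px] := H k; exists x.
exists (\big[Num.min/1]_(k < n) f k).
  by apply: lt_bigmin => // k _; have [] := Pf k.
by move=> k; have [_] := Pf k; apply: mono; exact: bigmin_le.
Qed.

Lemma le_coord_rV_norm (R : realType) (n : nat) (x : 'rV[R]_n) (k : 'I_n) :
  `|x ord0 k| <= `|x|.
Proof.
rewrite [leRHS]mx_normrE.
exact: (le_bigmax _ (fun i => `|x i.1 i.2|) (ord0, k)).
Qed.

Lemma rV_norm_le (R : realType) (n : nat) (x : 'rV[R]_n) (M : R) :
  0 <= M -> (forall k, `|x ord0 k| <= M) -> `|x| <= M.
Proof.
move=> M0 xM; rewrite [leLHS]mx_normrE; apply: bigmax_le => // -[i k] _ /=.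
by rewrite [i]ord1.
Qed.

Lemma rV_coordB (R : realType) (n : nat) (x y : 'rV[R]_n) (k : 'I_n) :
  (x - y) ord0 k = x ord0 k - y ord0 k.
Proof. by rewrite !mxE. Qed.

Lemma yextS (R : realType) (n : nat) (y : 'rV[R]_n) (k : 'I_n) :
  yext y k.+1 = y ord0 k.
Proof. by rewrite /yext /= valK. Qed.

Lemma yext_last (R : realType) (n : nat) (y : 'rV[R]_n) : yext y n.+1 = 1.
Proof. by rewrite /yext /= insubF//= ltnn. Qed.

Lemma inS_mono (R : realType) (n : nat) (y : 'rV[R]_n) (i j : nat) :
  inS y -> (i <= j)%N -> (j <= n.+1)%N -> yext y i <= yext y j.
Proof.
move=> Sy; elim: j => [|j IH]; first by rewrite leqn0 => /eqP ->.
rewrite leq_eqVlt => /orP[/eqP -> //|ij] jn.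
by apply: (le_trans (IH ij (ltnW jn))); apply/ltW/Sy.
Qed.

Lemma inS_bounds (R : realType) (n : nat) (y : 'rV[R]_n) (k : 'I_n) :
  inS y -> 0 < y ord0 k /\ y ord0 k < 1.
Proof.
move=> Sy; split.
- have H : yext y 1 <= yext y k.+1 by apply: inS_mono; rewrite // leqW.
  by rewrite -yextS; apply: lt_le_trans H; exact: (Sy 0%N).
- have H : yext y k.+1 <= yext y n by apply: inS_mono; rewrite // leqnSn.
  by rewrite -yextS -(yext_last y); apply: (le_lt_trans H); exact: Sy.
Qed.

(** * The suprema m_j *)

Section SumsOfTranslates.
Variables (R : realType) (n : nat) (K : 'I_n -> R -> R) (J : R -> \bar R).
Implicit Types (x y a b : 'rV[R]_n) (s t : R).

(* The points of I_j(y) at which F(y, .) is finite; node [k : 'I_n] is the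
   paper's y_(k+1), hence lies to the left of I_j exactly when [k < j]. *)
Definition cell y (j : nat) t : Prop :=
  [/\ 0 <= t <= 1, J t != -oo%E, forall k : 'I_n, (k < j)%N -> y ord0 k < t &
      forall k : 'I_n, (j <= k)%N -> t < y ord0 k].

(** With [K] in place of [kext], the value is meaningful only on a [cell], where it agrees with
    [Ffun]. *)
Definition Freal y t : R := fine (J t) + \sum_(k < n) K k (t - y ord0 k).

Lemma cell_itv y j t : inS y -> (j <= n)%N -> cell y j t ->
  yext y j <= t <= yext y j.+1.
Proof.
move=> Sy jn [/andP[t0 t1] _ Hl Hr]; apply/andP; split.
- case: j jn Hl Hr => [|j] jn Hl Hr; first by rewrite /yext.
  by rewrite (yextS y (Ordinal jn)); apply/ltW/Hl => /=.
- move: jn; rewrite leq_eqVlt => /orP[/eqP -> |jn]; first by rewrite yext_last.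
  by rewrite (yextS y (Ordinal jn)); apply/ltW/Hr => /=.
Qed.

Lemma cell_neq y j t (k : 'I_n) : cell y j t -> t - y ord0 k != 0.
Proof.
case=> _ _ Hl Hr; rewrite subr_eq0; have [kj|jk] := ltnP k j.
- by rewrite gt_eqF// Hl.
- by rewrite lt_eqF// Hr.
Qed.

Hypothesis KS : forall k, singular_kernel (K k).
Variable M : R.
Hypothesis JM : forall t, 0 <= t <= 1 -> (J t <= M%:E)%E.

Lemma J_fin t : 0 <= t <= 1 -> J t != -oo%E -> J t = (fine (J t))%:E.
Proof.
move=> t01 JN; rewrite fineK// fin_numE JN /=.
by apply/negP => /eqP E; have := JM t01; rewrite E.
Qed.

Lemma cell_Ffun y j t : inS y -> cell y j t -> Ffun K J y t = (Freal y t)%:E.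
Proof.
move=> Sy ct; have [t01 JN _ _] := ct.
rewrite /Ffun /Freal EFinD -J_fin// -sumEFin; congr (_ + _)%E.
apply: eq_bigr => k _; have [y0 y1] := inS_bounds k Sy.
by rewrite kextE ?(cell_neq k ct)//; move/andP: t01 => [? ?]; lra.
Qed.

(** A singular kernel makes [Ffun] equal to -oo at its node, so a finite value forces strict
    inequalities with all nodes. *)
Lemma Ffun_cell y j t : inS y -> (j <= n)%N ->
  yext y j <= t <= yext y j.+1 -> Ffun K J y t != -oo%E -> cell y j t.
Proof.
move=> Sy jn /andP[lt tr] FN.
have yt k : y ord0 k != t.
  apply: contraNneq FN => <-; rewrite /Ffun.
  rewrite (_ : (\sum_(j0 < n) _)%E = -oo%E) ?addeNy//.
  apply/esum_eqNyP; exists k; split; rewrite ?mem_index_enum//.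
  by rewrite subrr; case: (KS k).
split.
- apply/andP; split.
  + have y0 : 0 <= yext y j by exact: (inS_mono Sy (leq0n j) (leqW jn)).
    exact: le_trans lt.
  + by apply: (le_trans tr); rewrite -(yext_last y); apply: inS_mono.
- by apply: contraNneq FN; rewrite /Ffun => ->; rewrite addNye.
- move=> k kj; rewrite lt_neqAle yt /=; apply: le_trans lt.
  by rewrite -yextS; apply: inS_mono; rewrite // leqW.
- move=> k jk; rewrite lt_neqAle eq_sym yt /=; apply: (le_trans tr).
  by rewrite -yextS; apply: inS_mono; rewrite // leqW.
Qed.


(** Nonempty cells already force [inS], since a point of each cell separates consecutive nodes. *)
Lemma regsetP y :
  regset K J y <-> forall j, (j <= n)%N -> exists t, cell y j t.
Proof.
split=> [[Sy Hm] j jn|H].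
- apply: contrapT => nex; move/eqP: (Hm j jn); apply.
  apply/ereal_sup_ninfty => _ [t /= tI <-]; rewrite in_itv /= in tI.
  apply/eqP; apply: contrapT => /negP FN; apply: nex; exists t.
  exact: Ffun_cell.
have Sy : inS y.
  move=> j jn; have [t [/andP[t0 t1] _ Hl Hr]] := H j jn.
  have L : yext y j <= t /\ (j != 0%N -> yext y j < t).
    case: j jn Hl Hr => [|j] jn Hl Hr; first by rewrite /yext.
    have := Hl (Ordinal jn) (ltnSn j).
    by rewrite -yextS /= => yt; split; [exact: ltW|].
  have U : t <= yext y j.+1 /\ (j != n -> t < yext y j.+1).
    have [-> |jN] := eqVneq j n; first by rewrite yext_last.
    have jn' : (j < n)%N by rewrite ltn_neqAle jN jn.
    have := Hr (Ordinal jn') (leqnn j).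
    by rewrite -yextS /= => yt; split; [exact: ltW|].
  have [j0|j0] := eqVneq j 0%N; last exact: lt_le_trans (L.2 j0) U.1.
  have [jE|jN] := eqVneq j n; last exact: le_lt_trans L.1 (U.2 jN).
  (* Here [j = 0 = n]: there are no nodes and the claim reads [0 < 1]. *)
  by rewrite {2}jE yext_last j0 /yext.
split=> // j jn; have [t ct] := H j jn.
apply/eqP => /ereal_sup_ninfty /(_ (Ffun K J y t)).
rewrite (cell_Ffun Sy ct) /= => Hn; suff : (Freal y t)%:E = -oo%E :> \bar R by [].
apply: Hn; exists t; last exact: cell_Ffun Sy ct.
by rewrite /= in_itv /=; exact: cell_itv.
Qed.

Lemma kernel_cell_le : exists2 C, 0 <= C & forall y j t, inS y -> cell y j t ->
  forall k, K k (t - y ord0 k) <= C.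
Proof.
have [|k|C C0 HC] := @ord_uniform_ge R n
  (fun k C => forall s, s != 0 -> -1 < s -> s < 1 -> K k s <= C).
- by move=> k u u' uu' H s s0 s1 s2; apply: le_trans uu'; exact: H.
- by have [/kernel_bounded_above] := KS k.
exists C => // y j t Sy ct k; have [/andP[t0 t1] _ _ _] := ct.
have [y0 y1] := inS_bounds k Sy.
by apply: HC; [exact: cell_neq ct|lra|lra].
Qed.

Definition mreal j y : R := fine (Defs.mfun K J j y).

(** Regularity excludes -oo and the upper bounds on [J] and the kernels exclude +oo, so [fine] loses
    nothing here. *)
Lemma mfunE y j : regset K J y -> (j <= n)%N ->
  Defs.mfun K J j y = (mreal j y)%:E.
Proof.
move=> [Sy Hm] jn; rewrite fineK// fin_numE (Hm j jn) /=.
have [C C0 HC] := kernel_cell_le.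
rewrite -ltey; apply: (@le_lt_trans _ _ (M + n%:R * C)%:E); last exact: ltry.
apply: ge_ereal_sup => _ [t /= tI <-]; rewrite in_itv /= in tI.
have [-> |FN] := eqVneq (Ffun K J y t) -oo%E; first exact: leNye.
have ct := Ffun_cell Sy jn tI FN; have [t01 JN _ _] := ct.
rewrite (cell_Ffun Sy ct) lee_fin; apply: lerD.
  by rewrite -lee_fin -J_fin// JM.
have -> : n%:R * C = \sum_(k < n) C by rewrite sumr_const card_ord mulr_natl.
by apply: ler_sum => k _; exact: HC ct k.
Qed.

Lemma Freal_le_mreal y j t :
  regset K J y -> (j <= n)%N -> cell y j t -> Freal y t <= mreal j y.
Proof.
move=> Yy jn ct; have [Sy _] := Yy.
rewrite -lee_fin -mfunE// -(cell_Ffun Sy ct); apply: ereal_sup_ubound.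
by exists t => //=; rewrite in_itv /=; exact: cell_itv.
Qed.

(** Points of the interval outside the cell contribute -oo to the supremum. *)
Lemma mreal_le y j u : regset K J y -> (j <= n)%N ->
  (forall t, cell y j t -> Freal y t <= u) -> mreal j y <= u.
Proof.
move=> Yy jn H; have [Sy _] := Yy.
rewrite -lee_fin -mfunE//; apply: ge_ereal_sup => _ [t /= tI <-].
rewrite in_itv /= in tI.
have [-> |FN] := eqVneq (Ffun K J y t) -oo%E; first exact: leNye.
have ct := Ffun_cell Sy jn tI FN.
by rewrite (cell_Ffun Sy ct) lee_fin; exact: H.
Qed.

(** Near node [k], [K k] drops below [B - M - n%:R * C], while [J] is at most [M] and the other
    kernels sum to at most [n%:R * C]. The distance [d] does not depend on [y]. *)
Lemma cell_sep B : exists2 d, 0 < d & forall y j t, inS y -> cell y j t ->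
  B <= Freal y t -> forall k, d <= `|t - y ord0 k|.
Proof.
have [C C0 HC] := kernel_cell_le.
have [|k|d d0 Hd] := @ord_uniform_pos R n (fun k d => forall s, s != 0 ->
    `|s| < d -> K k s < B - M - n%:R * C).
- by move=> k u u' uu' H s s0 su; apply: H => //; exact: lt_le_trans uu'.
- by have [d d0 Hd] := singular_kernel_lt (B - M - n%:R * C) (KS k); exists d.
exists d => // y j t Sy ct BF k; rewrite leNgt; apply/negP => td.
have := Hd k _ (cell_neq k ct) td; have [t01 JN _ _] := ct.
have : fine (J t) <= M by rewrite -lee_fin -J_fin// JM.
have : \sum_(i < n | i != k) K i (t - y ord0 i) <= n%:R * C.
  have -> : n%:R * C = \sum_(k < n) C by rewrite sumr_const card_ord mulr_natl.
  rewrite [leRHS](bigD1 k)//= -[leLHS]add0r; apply: lerD => //.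
  by apply: ler_sum => i _; exact: HC ct i.
move: BF; rewrite /Freal (bigD1 k)//=; lra.
Qed.

Lemma cell_near a b j t d : cell a j t ->
  (forall k, d <= `|t - a ord0 k|) -> (forall k, `|a ord0 k - b ord0 k| < d) ->
  cell b j t.
Proof.
move=> [t01 JN Hl Hr] Hd ab; split => // k kj.
- have := ab k; have := Hd k; have := Hl k kj => ak.
  by rewrite gtr0_norm ?subr_gt0// ltr_norml => ? /andP[? ?]; lra.
- have := ab k; have := Hd k; have := Hr k kj => ak.
  by rewrite ltr0_norm ?subr_lt0// ltr_norml => ? /andP[? ?]; lra.
Qed.
End SumsOfTranslates.

(** * Monotonicity of the difference function *)

Section DifferenceFunction.
Variables (R : realType) (n : nat) (K : 'I_n -> R -> R) (J : R -> \bar R).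
Implicit Types (x y a b : 'rV[R]_n) (s t : R).
Variables (c M : R).
Hypothesis c0 : 0 < c.
Hypothesis KS : forall k, singular_kernel (K k).
Hypothesis KPM : forall k, PM c (K k).
Hypothesis JM : forall t, 0 <= t <= 1 -> (J t <= M%:E)%E.

Notation Y := (regset K J).
Notation m := (mreal K J).
Notation Phi := (Phi K J).
Notation "x <=v y" := (forall k : 'I_n, x ord0 k <= y ord0 k) (at level 70).

Lemma PhiE y (k : 'I_n) : Phi y ord0 k = m k.+1 y - m k y.
Proof. by rewrite mxE. Qed.

Lemma sum_Phi y : \sum_(k < n) Phi y ord0 k = m n y - m 0%N y.
Proof.
under eq_bigr do rewrite PhiE.
by rewrite -(big_mkord xpredT (fun k => m k.+1 y - m k y)) telescope_sumr.
Qed.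

Lemma mreal_add_le x y i j D Z : Y x -> Y y -> (i <= n)%N -> (j <= n)%N ->
  (forall t s, cell J x i t -> cell J y j s ->
    Freal K J x t + Freal K J y s + D <= Z) ->
  m i x + m j y + D <= Z.
Proof.
move=> Yx Yy ni nj H.
suff : m i x <= Z - D - m j y by lra.
apply: (mreal_le KS JM Yx ni) => t ct.
suff : m j y <= Z - D - Freal K J x t by lra.
by apply: (mreal_le KS JM Yy nj) => s cs; have := H t s ct cs; lra.
Qed.

Lemma Freal_exchange x y t s (d : 'I_n -> R) :
  (forall k, K k (t - x ord0 k) + K k (s - y ord0 k) + d k <=
             K k (t - y ord0 k) + K k (s - x ord0 k)) ->
  Freal K J x t + Freal K J y s + \sum_(k < n) d k <=
  Freal K J y t + Freal K J x s.
Proof.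
move=> H.
have : \sum_(k < n) (K k (t - x ord0 k) + K k (s - y ord0 k) + d k) <=
    \sum_(k < n) (K k (t - y ord0 k) + K k (s - x ord0 k)).
  by apply: ler_sum => k _; exact: H.
rewrite !big_split /= /Freal; lra.
Qed.

(** As the [k]-th nodes coincide, they separate [s] from [t], and the two points may exchange
    configurations. Any other node has [s] and [t] on the same side in both of its positions, so
    concavity on one branch suffices. *)
Lemma Phi_mono x y (k : 'I_n) : Y x -> Y y -> x <=v y -> x ord0 k = y ord0 k ->
  Phi x ord0 k <= Phi y ord0 k.
Proof.
move=> Yx Yy xy xyk; rewrite !PhiE.
suff : m k.+1 x + m k y + 0 <= m k.+1 y + m k x by lra.
have kn : (k <= n)%N by exact: ltnW.
apply: mreal_add_le => // t s ct cs.
have [t01 Jt tl tr] := ct; have [s01 Js sl sr] := cs.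
have sk : s < y ord0 k by exact: sr.
have kt : x ord0 k < t by exact: tl.
have ct' : cell J y k.+1 t.
  split => // i; last by move=> /tr ti; apply: lt_le_trans (xy i).
  rewrite ltnS leq_eqVlt => /orP[/eqP/val_inj -> |/sl]; first by rewrite -xyk.
  by move=> /lt_trans; apply; rewrite (lt_trans sk)// -xyk.
have cs' : cell J x k s.
  split => // i; first by move=> /sl; apply: le_lt_trans.
  rewrite leq_eqVlt => /orP[/eqP/val_inj <- |/tr]; first by rewrite xyk.
  by apply: lt_trans; rewrite (lt_trans sk)// -xyk.
apply: (@le_trans _ _ (Freal K J y t + Freal K J x s)); last first.
  by apply: lerD; apply: (Freal_le_mreal KS JM).
rewrite [X in _ + X <= _](_ : 0 = \sum_(i < n) 0); last by rewrite big1.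
apply: Freal_exchange => i.
have [cl cr _] := (KS i).1.
have [[Sx _] [Sy _]] := (Yx, Yy).
have [x0 x1] := inS_bounds i Sx; have [y0 y1] := inS_bounds i Sy.
have xyi := xy i.
case: (ltngtP i k) => ik.
- have /sl ? := ik; have /tl ? := ltnW ik : (i < k.+1)%N.
  have := @concave_on_4pt _ (K i) 0 1 (s - y ord0 i) (t - y ord0 i)
    (s - x ord0 i) (t - x ord0 i) cr ltac:(lra) ltac:(lra) ltac:(lra)
    ltac:(lra) ltac:(ring).
  lra.
- have /tr ? := ik; have /sr ? := ltnW ik.
  have := @concave_on_4pt _ (K i) (-1) 0 (s - y ord0 i) (t - y ord0 i)
    (s - x ord0 i) (t - x ord0 i) cl ltac:(lra) ltac:(lra) ltac:(lra)
    ltac:(lra) ltac:(ring).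
  lra.
- by rewrite (val_inj ik) xyk; lra.
Qed.

(** The sum telescopes to [m n - m 0]. All nodes lie between [s] in cell 0 of [x] and [t] in cell
    [n] of [y], so [kernel_swap] gains [c] times the displacement of each. *)
Lemma sum_Phi_decr x y : Y x -> Y y -> x <=v y ->
  \sum_(k < n) Phi y ord0 k + c * \sum_(k < n) (y ord0 k - x ord0 k) <=
  \sum_(k < n) Phi x ord0 k.
Proof.
move=> Yx Yy xy; rewrite !sum_Phi mulr_sumr.
set D := \sum_(k < n) _.
suff : m 0%N x + m n y + D <= m 0%N y + m n x by lra.
apply: mreal_add_le => // s t cs ct.
have [s01 Js sl sr] := cs; have [t01 Jt tl tr] := ct.
have cs' : cell J y 0 s.
  by split => // i i0; apply: lt_le_trans (xy i); exact: sr.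
have ct' : cell J x n t.
  split => // i; last by rewrite leqNgt ltn_ord.
  by move=> /tl; apply: le_lt_trans.
apply: (@le_trans _ _ (Freal K J y s + Freal K J x t)); last first.
  by apply: lerD; apply: (Freal_le_mreal KS JM).
apply: Freal_exchange => i.
have [[Sx _] [Sy _]] := (Yx, Yy).
have [x0 x1] := inS_bounds i Sx; have [y0 y1] := inS_bounds i Sy.
have := sr i isT; have := tl i (ltn_ord i) => yt sx.
move/andP: s01 => [s0 s1]; move/andP: t01 => [t0 t1].
exact: (kernel_swap (KS i).1 (KPM i)).
Qed.

Lemma regset_max x y : Y x -> Y y ->
  Y (\row_k Num.max (x ord0 k) (y ord0 k)).
Proof.
move=> Yx Yy; apply/(regsetP KS JM) => j jn.
have [t [t01 Jt tl tr]] := (regsetP KS JM x).1 Yx j jn.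
have [s [s01 Js sl sr]] := (regsetP KS JM y).1 Yy j jn.
exists (Num.max t s); split.
- by case: (leP t s).
- by case: (leP t s).
- move=> k kj; rewrite mxE gt_max !lt_max.
  by rewrite tl// sl// orbT.
- move=> k jk; rewrite mxE gt_max !lt_max.
  by rewrite tr// sr// orbT.
Qed.

(** Where [w] agrees with [y], [Phi_mono] gives [Phi x - Phi w <= Phi x - Phi y]; where it agrees
    with [x], [Phi x - Phi w <= 0]. The sum bounds the decrease from [x] to [w] in
    [sum_Phi_decr]. *)
Lemma Phi_inv_coord x y (k : 'I_n) : Y x -> Y y ->
  c * (y ord0 k - x ord0 k) <= n%:R * `|Phi x - Phi y|.
Proof.
move=> Yx Yy.
pose w : 'rV[R]_n := \row_k Num.max (x ord0 k) (y ord0 k).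
have Yw : Y w by exact: regset_max.
have xw : x <=v w by move=> i; rewrite mxE le_max lexx.
have yw : y <=v w by move=> i; rewrite mxE le_max lexx orbT.
have S := sum_Phi_decr Yx Yw xw.
have : \sum_(i < n) (Phi x ord0 i - Phi w ord0 i) <= n%:R * `|Phi x - Phi y|.
  have -> : n%:R * `|Phi x - Phi y| = \sum_(i < n) `|Phi x - Phi y|.
    by rewrite sumr_const card_ord mulr_natl.
  apply: ler_sum => i _; have [xy|yx] := leP (x ord0 i) (y ord0 i).
  - have : y ord0 i = w ord0 i by rewrite mxE max_r.
    move=> /(Phi_mono Yy Yw yw) H.
    apply: le_trans (le_coord_rV_norm (Phi x - Phi y) i).
    by apply: le_trans (ler_norm _); rewrite rV_coordB; lra.
  - have : x ord0 i = w ord0 i by rewrite mxE max_l// ltW.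
    by move=> /(Phi_mono Yx Yw xw) H; have := normr_ge0 (Phi x - Phi y); lra.
rewrite sumrB => HS.
have : y ord0 k - x ord0 k <= \sum_(i < n) (w ord0 i - x ord0 i).
  rewrite (bigD1 k)//= -[leLHS]addr0; apply: lerD; first by rewrite lerD2r.
  by apply: sumr_ge0 => i _; rewrite subr_ge0.
move=> /(ler_wpM2l (ltW c0)); lra.
Qed.

Lemma Phi_inv_lipschitz x y : Y x -> Y y ->
  `|x - y| <= n%:R / c * `|Phi x - Phi y|.
Proof.
move=> Yx Yy; have N0 := normr_ge0 (Phi x - Phi y).
apply: rV_norm_le; first by rewrite mulr_ge0// divr_ge0// ltW.
move=> k; rewrite mulrAC ler_pdivlMr// mulrC.
rewrite -[X in X * _](gtr0_norm c0) -normrM.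
rewrite ler_norml rV_coordB.
have := Phi_inv_coord k Yx Yy; have := Phi_inv_coord k Yy Yx.
rewrite [`|Phi y - _|]distrC => H1 H2; apply/andP; split; lra.
Qed.
End DifferenceFunction.

(** * Local Lipschitz continuity, compactness and surjectivity *)

Lemma kernel_bounded_below (R : realType) (K : R -> R) (e : R) :
  kernel_function K -> 0 < e ->
  exists C, forall s, e <= `|s| -> `|s| <= 1 - e -> - C <= K s.
Proof.
move=> [cl cr _] e0.
have [M1 H1] := @concave_on_bounded_below _ K (-1) 0 (-1 + e) (- e) cl
  ltac:(lra) ltac:(lra).
have [M2 H2] := @concave_on_bounded_below _ K 0 1 e (1 - e) cr
  ltac:(lra) ltac:(lra).
exists (- Num.min M1 M2) => s; rewrite opprK ge_min.
have [s0|s0] := ger0P s => es se; first by rewrite H2 ?orbT.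
by rewrite H1//; lra.
Qed.

(** Two arguments of modulus at least [e] and distance less than [e] have the same sign, so a single
    branch is involved. *)
Lemma kernel_lipschitz (R : realType) (K : R -> R) (e : R) :
  kernel_function K -> 0 < e ->
  exists L, forall u v, e <= `|u| -> `|u| <= 1 - e -> `|v| <= 1 - e ->
    e <= `|v| -> `|u - v| < e -> `|K u - K v| <= L * `|u - v|.
Proof.
move=> [cl cr _] e0.
have [L1 L10 H1] := @concave_on_lipschitz _ K (-1) 0 (-1 + e) (- e) cl
  ltac:(lra) ltac:(lra).
have [L2 L20 H2] := @concave_on_lipschitz _ K 0 1 e (1 - e) cr
  ltac:(lra) ltac:(lra).
exists (L1 + L2) => u v eu ue ve ev /ltr_normlP[uv1 uv2].
have uv0 := normr_ge0 (u - v); rewrite mulrDl.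
have P1 : 0 <= L1 * `|u - v| by apply: mulr_ge0.
have P2 : 0 <= L2 * `|u - v| by apply: mulr_ge0.
move: eu ue ve ev; have [u0|u0] := ger0P u; have [v0|v0] := ger0P v => *.
- by have := H2 u v ltac:(lra) ltac:(lra) ltac:(lra) ltac:(lra); lra.
- by exfalso; lra.
- by exfalso; lra.
- by have := H1 u v ltac:(lra) ltac:(lra) ltac:(lra) ltac:(lra); lra.
Qed.

Lemma seq_separation (R : realType) (s : seq R) :
  exists2 d, 0 < d &
    forall x y, x \in s -> y \in s -> x != y -> d <= `|x - y|.
Proof.
have H (x y : R) : exists2 d, 0 < d & x != y -> d <= `|x - y|.
  have [->|xy] := eqVneq x y; first by exists 1.
  by exists `|x - y|; rewrite // normr_gt0 subr_eq0.
have [|i|d d0 Hd] := @ord_uniform_pos R (size s)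
  (fun i d => forall j : 'I_(size s), s`_i != s`_j -> d <= `|s`_i - s`_j|).
- by move=> i d d' dd' Hi j ij; exact: le_trans dd' (Hi j ij).
- have [|j|d d0 Hd] := @ord_uniform_pos R (size s)
    (fun j d => s`_i != s`_j -> d <= `|s`_i - s`_j|).
  + by move=> j d d' dd' Hi ij; exact: le_trans dd' (Hi ij).
  + exact: H.
  + by exists d.
exists d => // x y /(nthP 0)[i si <-] /(nthP 0)[j sj <-].
exact: (Hd (Ordinal si) (Ordinal sj)).
Qed.

Lemma lipschitz_at_continuous (R : realType) (V W : normedModType R)
    (f : V -> W) (x : V) (r L : R) : 0 < r ->
  (forall a, `|a - x| < r -> `|f a - f x| <= L * `|a - x|) ->
  {for x, continuous f}.
Proof.
move=> r0 fL; apply/cvgrPdist_lt => e e0.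
have L0 : 0 < `|L| + 1 by rewrite ltr_wpDl.
near=> a.
have ar : `|a - x| < r.
  near: a; apply/nbhs_ballP; exists r => //= a.
  by rewrite -ball_normE /= distrC.
have ae : `|a - x| < e / (`|L| + 1).
  near: a; apply/nbhs_ballP; exists (e / (`|L| + 1)); first exact: divr_gt0.
  by move=> a; rewrite -ball_normE /= distrC.
rewrite distrC; apply: (le_lt_trans (fL a ar)).
move: ae; rewrite ltr_pdivlMr//; apply: le_lt_trans.
rewrite mulrC; apply: ler_wpM2l => //.
by apply: (le_trans (ler_norm L)); rewrite lerDl.
Unshelve. all: by end_near. Qed.

Lemma closure_norm (R : realType) (V : normedModType R) (A : set V) (x : V)
    (e : R) : closure A x -> 0 < e -> exists2 a, A a & `|a - x| < e.
Proof.
move=> cA e0; have [a [Aa]] := cA _ (nbhsx_ballx x e e0).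
by rewrite -ball_normE /= distrC => xa; exists a.
Qed.

Section Surjectivity.
Variables (R : realType) (n : nat) (K : 'I_n -> R -> R) (J : R -> \bar R).
Implicit Types (x y z a b : 'rV[R]_n) (s t : R).
Variables (c M : R).
Hypothesis c0 : 0 < c.
Hypothesis KS : forall k, singular_kernel (K k).
Hypothesis KPM : forall k, PM c (K k).
Hypothesis JM : forall t, 0 <= t <= 1 -> (J t <= M%:E)%E.

Notation Y := (regset K J).
Notation m := (mreal K J).
Notation Phi := (Phi K J).

Lemma coord_lt x y (k : 'I_n) (e : R) :
  `|x - y| < e -> `|x ord0 k - y ord0 k| < e.
Proof.
by rewrite -rV_coordB; apply: le_lt_trans; exact: le_coord_rV_norm.
Qed.

(** One chosen point per cell of [y0] stays in its cell when the nodes move slightly; hence the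
    regularity set is open, and the values at these points bound all [m j] from below near [y0]. *)
Lemma regset_interior y0 : Y y0 -> exists e B, [/\ 0 < e,
  forall a t, `|a - y0| < e -> 0 <= t <= 1 ->
    forall k, `|t - a ord0 k| <= 1 - e &
  forall a, `|a - y0| < e -> Y a /\ forall j, (j <= n)%N -> B <= m j a].
Proof.
move=> Yy; have [Sy _] := Yy.
have /choice[f cf] (j : 'I_n.+1) : exists t, cell J y0 j t.
  by apply: (regsetP KS JM y0).1 => //; rewrite -ltnS.
have [|j|d1 d10 Hd1] := @ord_uniform_pos R n.+1
  (fun j d => forall k, d <= `|f j - y0 ord0 k|).
- by move=> j d d' dd' H k; exact: le_trans dd' (H k).
- have [|k|d d0 Hd] := @ord_uniform_pos R n
    (fun k d => d <= `|f j - y0 ord0 k|).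
  + by move=> k d d' dd' H; exact: le_trans dd' H.
  + exists `|f j - y0 ord0 k| => //; rewrite normr_gt0; exact: cell_neq (cf j).
  + by exists d.
have [|k|d2 d20 Hd2] := @ord_uniform_pos R n
  (fun k d => d <= y0 ord0 k /\ d <= 1 - y0 ord0 k).
- by move=> k d d' dd' [H1 H2]; split; lra.
- have [? ?] := inS_bounds k Sy.
  exists (Num.min (y0 ord0 k) (1 - y0 ord0 k)).
    by rewrite lt_min; apply/andP; split; lra.
  by rewrite !ge_min !lexx orbT.
(* The half leaves a margin [e] after a move smaller than [e], both between chosen points and nodes
   and between nodes and 0 or 1. *)
pose e := Num.min d1 d2 / 2.
have e0 : 0 < e by rewrite divr_gt0// lt_min d10.
have e1 : 2 * e <= d1 by rewrite mulrC divfK// ge_min lexx.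
have e2 : 2 * e <= d2 by rewrite mulrC divfK// ge_min lexx orbT.
have far a t : `|a - y0| < e -> 0 <= t <= 1 ->
    forall k, `|t - a ord0 k| <= 1 - e.
  move=> ay /andP[t0 t1] k; have /ltr_normlP[? ?] := coord_lt k ay.
  by have [? ?] := Hd2 k; rewrite ler_norml; apply/andP; split; lra.
have [|k|C C0 HC] := @ord_uniform_ge R n (fun k C => forall s,
    e <= `|s| -> `|s| <= 1 - e -> - C <= K k s).
- by move=> k C C' CC' H s s1 s2; have := H s s1 s2; lra.
- exact: kernel_bounded_below (KS k).1 e0.
have [|j|D D0 HD] := @ord_uniform_ge R n.+1 (fun j D => - D <= fine (J (f j))).
- by move=> j D D' DD' H; lra.
- by exists (- fine (J (f j))); rewrite opprK.
exists e, (- D - n%:R * C); split => // a ay.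
have ca (j : 'I_n.+1) : cell J a j (f j).
  apply: (@cell_near _ _ _ y0 a j (f j) d1) => // k.
  by have := coord_lt k ay; rewrite distrC; lra.
have Ya : Y a.
  apply/(regsetP KS JM) => j; rewrite -ltnS => jn.
  by exists (f (Ordinal jn)); exact: ca.
split => // j; rewrite -ltnS => jn; pose j' := Ordinal jn.
apply: le_trans (Freal_le_mreal KS JM Ya (jn : (j <= n)%N) (ca j')).
rewrite /Freal; apply: lerD; first exact: HD.
have -> : - (n%:R * C) = \sum_(k < n) - C.
  by rewrite sumr_const card_ord mulNrn mulr_natl.
apply: ler_sum => k _; apply: HC; last by apply: far => //; case: (ca j').
have := Hd1 j' k; have := coord_lt k ay.
have := ler_normD (f j' - a ord0 k) (a ord0 k - y0 ord0 k).
rewrite addrA subrK; lra.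
Qed.

(** Points of value below [B] are harmless because [B <= m j b]. The others keep a uniform distance
    from the nodes, so they also lie in the cell of [b], and the kernels are Lipschitz there. *)
Lemma mreal_loc_lipschitz y0 : Y y0 -> exists r L, [/\ 0 < r, 0 <= L &
  forall a b, `|a - y0| < r -> `|b - y0| < r ->
    Y a /\ forall j, (j <= n)%N -> m j a <= m j b + L * `|a - b|].
Proof.
move=> /regset_interior[e [B [e0 far near]]].
have [d d0 Hd] := cell_sep KS JM B.
(* [h <= d / 2] keeps [t] at distance at least [h] from the nodes of [b]; the radius [h / 2] gives
   [|a - b| < h]. *)
pose h := Num.min e (d / 2).
have h0 : 0 < h by rewrite lt_min e0 divr_gt0.
have [he hd] : h <= e /\ h <= d / 2 by rewrite !ge_min !lexx orbT.
have [|k|L L0 HL] := @ord_uniform_ge R n (fun k L => forall u v,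
    h <= `|u| -> `|u| <= 1 - h -> `|v| <= 1 - h -> h <= `|v| ->
    `|u - v| < h -> `|K k u - K k v| <= L * `|u - v|).
- move=> k L L' LL' H u v *; apply: le_trans (ler_wpM2r _ LL') => //.
  exact: H.
- exact: kernel_lipschitz (KS k).1 h0.
exists (h / 2), (n%:R * L); split; [lra|exact: mulr_ge0|] => a b ay bry.
have ae : `|a - y0| < e by lra.
have be : `|b - y0| < e by lra.
have ab : `|a - b| < h.
  by have := ler_distD y0 a b; rewrite [`|y0 - b|]distrC; lra.
have [Ya _] := near a ae; have [Yb mb] := near b be.
split => // j jn; apply: (mreal_le KS JM Ya jn) => t ct.
have LN : 0 <= n%:R * L * `|a - b| by rewrite !mulr_ge0.
have [FB|BF] := ltP (Freal K J a t) B; first by have := mb j jn; lra.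
have sep := Hd a j t Ya.1 ct BF.
have cb : cell J b j t.
  by apply: (cell_near ct sep) => k; have := coord_lt k ab; lra.
have /= := Freal_le_mreal KS JM Yb jn cb.
suff : Freal K J a t <= Freal K J b t + n%:R * L * `|a - b| by lra.
rewrite /Freal -addrA lerD2l.
have -> : n%:R * L * `|a - b| = \sum_(k < n) L * `|a - b|.
  by rewrite sumr_const card_ord -mulrA mulr_natl.
rewrite -big_split /=; apply: ler_sum => k _.
have t01 : 0 <= t <= 1 by case: ct.
have abk := coord_lt k ab.
have E : t - a ord0 k - (t - b ord0 k) = - (a ord0 k - b ord0 k) by ring.
have fa := far a t ae t01 k; have fb := far b t be t01 k; have sk := sep k.
have tb : h <= `|t - b ord0 k|.
  have := ler_normD (t - b ord0 k) (- (a ord0 k - b ord0 k)).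
  rewrite -E addrC subrK E normrN; lra.
have := HL k (t - a ord0 k) (t - b ord0 k) ltac:(lra) ltac:(lra) ltac:(lra) tb.
rewrite E normrN => /(_ abk) /(le_trans (ler_norm _)).
have : L * `|a ord0 k - b ord0 k| <= L * `|a - b|.
  by apply: ler_wpM2l => //; rewrite -rV_coordB; exact: le_coord_rV_norm.
lra.
Qed.

Lemma Phi_loc_lipschitz y0 : Y y0 -> exists r L, [/\ 0 < r, 0 < L &
  forall a b, `|a - y0| < r -> `|b - y0| < r ->
    Y a /\ `|Phi a - Phi b| <= L * `|a - b|].
Proof.
move=> /mreal_loc_lipschitz[r [L [r0 L0 H]]].
exists r, (2 * L + 1); split => // [|a b ar br]; first by lra.
have [Ya mab] := H a b ar br; have [_ mba] := H b a br ar.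
split => //; have N0 := normr_ge0 (a - b).
apply: rV_norm_le => [|k]; first by apply: mulr_ge0 => //; lra.
rewrite rV_coordB !PhiE ler_norml.
have := mab k (ltnW (ltn_ord k)); have := mba k (ltnW (ltn_ord k)).
have := mab k.+1 (ltn_ord k); have := mba k.+1 (ltn_ord k).
rewrite [`|b - a|]distrC => *; apply/andP; split; lra.
Qed.

(** For closedness, take [a] in the set near a closure point [y]: its cell points of value above
    [B - 1] are uniformly far from its nodes and so lie in the cells of [y]. They exist even if the
    suprema are not attained. *)
Lemma regset_ge_compact B :
  compact [set y | Y y /\ forall j, (j <= n)%N -> B <= m j y].
Proof.
apply: bounded_closed_compact.
- exists 1; split => // C C1 y [[Sy _] _] /=.
  apply: rV_norm_le => [|k]; first by lra.
  by have [? ?] := inS_bounds k Sy; rewrite ger0_norm; lra.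
move=> y cy.
have Yy : Y y.
  have [d d0 Hd] := cell_sep KS JM (B - 1).
  have [a [Ya Ba] ay] := closure_norm cy d0.
  apply/(regsetP KS JM) => j jn; apply: contrapT => nc.
  suff : m j a <= B - 1 by have := Ba j jn; lra.
  apply: (mreal_le KS JM Ya jn) => t ct; rewrite leNgt; apply/negP => Bt.
  apply: nc; exists t; apply: (cell_near ct (Hd a j t Ya.1 ct (ltW Bt))) => k.
  exact: coord_lt.
split => // j jn; apply/ler_addgt0Pr => e e0.
(* The lower bound passes to [y] by local Lipschitz continuity. *)
have [r [L [r0 L0 H]]] := mreal_loc_lipschitz Yy.
have L1 : 0 < L + 1 by lra.
have [|a [Ya Ba] ay] := @closure_norm _ _ _ _ (Num.min r (e / (L + 1))) cy.
  by rewrite lt_min r0 divr_gt0.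
move: ay; rewrite lt_min ltr_pdivlMr// => /andP[ar ae].
have [|_ /(_ j jn)] := H a y ar; first by rewrite subrr normr0.
have := Ba j jn; have := normr_ge0 (a - y); lra.
Qed.

(** The index is the least [j] from which on all nodes exceed [t]. *)
Lemma cell_exists y t : Y y -> 0 <= t <= 1 -> J t != -oo%E ->
  (forall k, t != y ord0 k) -> exists2 j, (j <= n)%N & cell J y j t.
Proof.
move=> [Sy _] t01 Jt ty.
pose P j := [forall k : 'I_n, (j <= k)%N ==> (t < y ord0 k)].
have Pn : P n by apply/forallP => k; rewrite leqNgt ltn_ord.
have [j /forallP Pj jmin] := ex_minnP (ex_intro P n Pn).
have jn := jmin n Pn; exists j => //; split => // k; last first.
  by move=> jk; have := Pj k; rewrite jk.
case: j Pj jmin jn => // j Pj jmin jn kj.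
(* Minimality yields a node [i >= j] with [y_i <= t], and node [k] is not to its right. *)
have /negP : ~ P j by move=> /jmin; rewrite ltnn.
rewrite negb_forall => /existsP[i]; rewrite negb_imply -leNgt => /andP[ji yt].
have ki : y ord0 k <= y ord0 i.
  rewrite -!yextS; apply: inS_mono => //; last exact: leqW.
  exact: leq_trans kj _.
by rewrite lt_neqAle eq_sym ty (le_trans ki).
Qed.

(** * Consequences of the n-field condition, and the minimization *)

Section Field.
Variable s : seq R.
Hypothesis us : uniq s.
Hypothesis Js : {in s, forall t, 0 <= t <= 1 /\ J t != -oo%E}.
Hypothesis ws : n%:R < \sum_(t <- s) weight t.

Lemma weight_le1 t : weight t <= 1.
Proof. by rewrite /weight; case: ifP => // _; lra. Qed.

Lemma weight_gt0 t : 0 < weight t.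
Proof. by rewrite /weight; case: ifP => // _; lra. Qed.

(** Weights are at most 1, so [s] has more than [n] points; midpoints of consecutive sorted points
    serve as nodes. *)
Lemma regset_nonempty : exists y, Y y.
Proof.
have sn : (n < size s)%N.
  rewrite -(ltr_nat R); apply: (lt_le_trans ws).
  have <- : \sum_(t <- s) (1 : R) = (size s)%:R.
    by rewrite big_const_seq count_predT iter_addr_0.
  by apply: ler_sum => t _; exact: weight_le1.
pose u := sort <=%R s.
have su : size u = size s by rewrite size_sort.
have lu i j : (i < j)%N -> (j <= n)%N -> u`_i < u`_j.
  move=> ij jn; apply: (sorted_ltn_nth lt_trans) => //.
  - by rewrite sort_lt_sorted.
  - by rewrite inE su; apply: leq_ltn_trans sn; apply: ltnW (leq_trans ij jn).
  - by rewrite inE su; exact: leq_ltn_trans sn.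
have lu' i j : (i <= j)%N -> (j <= n)%N -> u`_i <= u`_j.
  by rewrite leq_eqVlt => /orP[/eqP -> //|ij jn]; apply/ltW/lu.
exists (\row_(k < n) ((u`_k + u`_k.+1) / 2)).
apply/(regsetP KS JM) => j jn; exists u`_j.
have [t01 Jt] : 0 <= u`_j <= 1 /\ J u`_j != -oo%E.
  apply: Js; rewrite -(mem_sort <=%R); apply: mem_nth.
  by rewrite size_sort (leq_ltn_trans jn).
split => // k jk; rewrite mxE.
- have := lu k k.+1 (ltnSn k) (ltn_ord k); have := lu' k.+1 j jk jn; lra.
- have := lu k k.+1 (ltnSn k) (ltn_ord k).
  have := lu' j k jk (ltnW (ltn_ord k)); lra.
Qed.

(* Besides its singularity at 0, a kernel may tend to -oo at -1 and 1.  A node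
   close to an interior point of [s] spoils only that point; a node close to 0 or
   to 1 spoils at most the two end points, of weight 1/2 each. *)
Lemma spoiled_weight : exists2 d, 0 < d & forall u, 0 < u -> u < 1 ->
  \sum_(t <- s | ~~ (d <= `|t - u| <= 1 - d)) weight t <= 1.
Proof.
(* Adding 0 and 1 keeps inner points at distance [d] from the ends and yields [d <= 1]. *)
have [d d0 Hd] := seq_separation [:: 0, 1 & s].
have d1 : d <= 1.
  have := Hd 0 1; rewrite !inE !eqxx !orbT sub0r normrN1 => H.
  by apply: H; rewrite // eq_sym oner_neq0.
exists (d / 2); first by lra.
move=> u u0 u1; rewrite -big_filter.
set b := [seq t <- s | _].
have ub : uniq b by exact: filter_uniq.
have bP t : t \in b -> [/\ t \in s, 0 <= t <= 1 &
    `|t - u| < d / 2 \/ 1 - d / 2 < `|t - u|].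
  rewrite mem_filter => /andP[+ ts]; have [t01 _] := Js ts.
  by rewrite negb_and -!ltNge => /orP[]; split; auto.
pose inner t := (t != 0) && (t != 1).
have innerP t : t \in b -> inner t ->
    [/\ d <= t, t <= 1 - d & `|t - u| < d / 2].
  move=> /bP[ts /andP[t0 t1] tu] /andP[tn0 tn1].
  have D0 : d <= t.
    rewrite -[t]ger0_norm// -[t]subr0; apply: Hd => //.
      by rewrite !inE ts !orbT.
    by rewrite !inE eqxx.
  have D1 : t <= 1 - d.
    have := Hd t 1; rewrite !inE eqxx ts !orbT => /(_ isT isT tn1).
    by rewrite ler0_norm; lra.
  split => //; case: tu => // tu; exfalso.
  have : `|t - u| <= 1 - d by rewrite ler_norml; apply/andP; split; lra.
  lra.
have [/hasP[t tb it]|noinner] := boolP (has inner b).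
- have [dt td tu] := innerP t tb it; have [ts _ _] := bP t tb.
  (* Another spoiled inner point would be closer than [d] to [t], and [d / 2 < u < 1 - d / 2] leaves
     both end points unspoiled. *)
  have sub : {subset b <= [:: t]}.
    move=> t' t'b; rewrite inE; apply: contraT => tt'.
    have [t's t'01 t'u] := bP t' t'b.
    have := Hd t' t; rewrite !inE t's ts !orbT => /(_ isT isT tt') dtt'.
    move/andP: t'01 => [t'0 t'1]; move/ltr_normlP: tu => [tu1 tu2].
    have [it'|] := boolP (inner t').
      have [_ _ /ltr_normlP[? ?]] := innerP t' t'b it'.
      suff : `|t' - t| < d by lra.
      by rewrite ltr_norml; apply/andP; split; lra.
    rewrite negb_and !negbK => /orP[/eqP E|/eqP E]; subst t'.
    + by case: t'u; rewrite sub0r normrN gtr0_norm//; lra.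
    + by case: t'u; rewrite gtr0_norm; lra.
  have := uniq_leq_size ub sub; case: b {ub bP innerP tb sub} => [|v [|]]//= _.
  + by rewrite big_nil.
  + by rewrite big_seq1; exact: weight_le1.
- have sub : {subset b <= [:: 0; 1]}.
    move=> t tb; rewrite !inE; have /hasPn/(_ t tb) := noinner.
    by rewrite negb_and !negbK.
  have wE t : t \in b -> weight t = 2^-1.
    by move=> /sub; rewrite !inE /weight => ->.
  rewrite (eq_big_seq _ wE) big_const_seq count_predT iter_addr_0.
  have := uniq_leq_size ub sub; rewrite /= => b2.
  apply: (@le_trans _ _ (2^-1 *+ 2)); last by rewrite mulr2n; lra.
  by apply: ler_wpMn2l => //; rewrite invr_ge0.
Qed.

(** The [n] nodes spoil total weight at most [n], less than that of [s]; the value at an unspoiled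
    point of [s] is bounded below. *)
Lemma max_mreal_ge : exists B, forall y, Y y ->
  exists2 j, (j <= n)%N & B <= m j y.
Proof.
have [d d0 Hd] := spoiled_weight.
have [|k|C C0 HC] := @ord_uniform_ge R n (fun k C => forall u,
    d <= `|u| -> `|u| <= 1 - d -> - C <= K k u).
- by move=> k C C' CC' H u u1 u2; have := H u u1 u2; lra.
- exact: kernel_bounded_below (KS k).1 d0.
have [|j|D D0 HD] := @ord_uniform_ge R (size s)
  (fun j D => - D <= fine (J s`_j)).
- by move=> j D D' DD' H; lra.
- by exists (- fine (J s`_j)); rewrite opprK.
exists (- D - n%:R * C) => y Yy.
have [t ts good] : exists2 t, t \in s & forall k, d <= `|t - y ord0 k| <= 1 - d.
  apply: contrapT => nex; move: ws; apply/negP; rewrite -leNgt.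
  apply: (@le_trans _ _ (\sum_(k < n)
      \sum_(t <- s | ~~ (d <= `|t - y ord0 k| <= 1 - d)) weight t)).
    rewrite (exchange_big_dep xpredT) //= [leLHS]big_seq [leRHS]big_seq.
    apply: ler_sum => t ts.
    have [k bad] : exists k, ~~ (d <= `|t - y ord0 k| <= 1 - d).
      apply: contrapT => nk; apply: nex; exists t => // k.
      by apply: contrapT => bad; apply: nk; exists k; apply/negP.
    rewrite (bigD1 k)//= lerDl; apply: sumr_ge0 => i _.
    exact/ltW/weight_gt0.
  apply: (@le_trans _ _ (\sum_(k < n) 1)); last by rewrite sumr_const card_ord.
  by apply: ler_sum => k _; have [? ?] := inS_bounds k Yy.1; exact: Hd.
have [t01 Jt] := Js ts.
have [k|j jn ct] := cell_exists Yy t01 Jt.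
  have /andP[+ _] := good k; rewrite -subr_eq0 -normr_gt0.
  exact: lt_le_trans.
exists j => //; apply: le_trans (Freal_le_mreal KS JM Yy jn ct).
rewrite /Freal; apply: lerD.
  by have /(nthP 0)[i si <-] := ts; exact: (HD (Ordinal si)).
have -> : - (n%:R * C) = \sum_(k < n) - C.
  by rewrite sumr_const card_ord mulNrn mulr_natl.
by apply: ler_sum => k _; have /andP[? ?] := good k; exact: HC.
Qed.

(** [m l - m 0] is a partial sum of [Phi]; the factor 2 comes from comparing both indices with 0. *)
Lemma mreal_dist y i j : (i <= n)%N -> (j <= n)%N ->
  m i y <= m j y + 2 * \sum_(k < n) `|Phi y ord0 k|.
Proof.
have H l : (l <= n)%N -> `|m l y - m 0%N y| <= \sum_(k < n) `|Phi y ord0 k|.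
  move=> ln; rewrite -(telescope_sumr (fun k => m k y) (leq0n l)).
  apply: (le_trans (ler_norm_sum _ _ _)).
  rewrite big_mkord (big_ord_widen n (fun k => `|m k.+1 y - m k y|) ln).
  rewrite big_mkcond /=.
  by apply: ler_sum => k _; rewrite PhiE; case: ifP.
move=> /H /ler_normlP[? ?] /H /ler_normlP[? ?]; lra.
Qed.

Lemma Phi_surj z : exists2 y, Y y & Phi y = z.
Proof.
have [y0 Yy0] := regset_nonempty; have [B HB] := max_mreal_ge.
pose phi y := \sum_(k < n) `|Phi y ord0 k - z ord0 k|.
(* On the sublevel set of [y0] some [m i] is at least [B], and [mreal_dist] bounds the drop to every
   other [m j]; [B'] absorbs this drop. *)
pose B' := B - 2 * (phi y0 + \sum_(k < n) `|z ord0 k|).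
pose A := [set y | Y y /\ forall j, (j <= n)%N -> B' <= m j y].
have sublevel y : Y y -> phi y <= phi y0 -> A y.
  move=> Yy yy0; split => // j jn; have [i ni Bi] := HB y Yy.
  have := mreal_dist y ni jn.
  suff : \sum_(k < n) `|Phi y ord0 k| <= phi y + \sum_(k < n) `|z ord0 k|.
    by rewrite /B'; lra.
  rewrite -big_split /=; apply: ler_sum => k _.
  by rewrite -[X in `|X| <= _](subrK (z ord0 k)); exact: ler_normD.
have [|||x /set_mem[Yx _] xmin] := @compact_EVT_min _ R phi A.
- by exists y0; exact: sublevel.
- exact: regset_ge_compact.
- apply: continuous_in_subspaceT => y /set_mem[Yy _].
  have [r [L [r0 L0 H]]] := Phi_loc_lipschitz Yy.
  apply: (@lipschitz_at_continuous _ _ R^o _ _ r (n%:R * L) r0) => a ar.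
  have [|_ ay] := H a y ar; first by rewrite subrr normr0.
  rewrite /phi -sumrB; apply: (le_trans (ler_norm_sum _ _ _)).
  have -> : n%:R * L * `|a - y| = \sum_(k < n) L * `|a - y|.
    by rewrite sumr_const card_ord -mulrA mulr_natl.
  apply: ler_sum => k _; apply: le_trans ay.
  apply: le_trans (le_coord_rV_norm (Phi a - Phi y) k); rewrite rV_coordB.
  apply: (le_trans (ler_dist_dist _ _)).
  by rewrite opprB addrA subrK.
(* Outside the sublevel set [phi] exceeds [phi y0], so the minimum over [A] is global on the
   regularity set. *)
have {}xmin y : Y y -> phi x <= phi y.
  move=> Yy; have [yy0|/ltW y0y] := leP (phi y) (phi y0).
    by apply: xmin; apply: mem_set; exact: sublevel.
  by apply: le_trans y0y; apply: xmin; apply: mem_set; exact: sublevel.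
exists x => //; apply/rowP => i; apply/eqP; apply: contraT => xz; exfalso.
have [r [L [r0 L0 H]]] := Phi_loc_lipschitz Yx.
pose D := `|Phi x ord0 i - z ord0 i|.
have D0 : 0 < D by rewrite normr_gt0 subr_eq0.
(* [e < r] keeps the moved configuration regular, and [L * e <= D] prevents [Phi i] from crossing
   [z i]. *)
pose e := Num.min (r / 2) (D / L).
have e0 : 0 < e by rewrite lt_min !divr_gt0.
have er : e < r by rewrite gt_min; apply/orP; left; lra.
have eD : L * e <= D by rewrite mulrC -ler_pdivlMr// ge_min lexx orbT.
pose v : 'rV[R]_n := \row_k (e *+ (k == i)).
have vE k : v ord0 k = e *+ (k == i) by rewrite mxE.
have vr : `|v| <= e.
  apply: rV_norm_le => [|k]; first exact: ltW.
  by rewrite vE; case: eqP => _; rewrite ?normr0 ?mulr1n ?gtr0_norm// ltW.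
have sumv : \sum_(k < n) v ord0 k = e.
  rewrite (bigD1 i)//= vE eqxx big1 ?addr0// => k /negbTE ki.
  by rewrite vE ki.
have xx : `|x - x| < r by rewrite subrr normr0.
(* If [Phi i] is too large, node [i] moves right. The [i]-th term of [phi] changes exactly as
   [Phi i], every other term grows by at most the increase of its [Phi k], so [phi] drops by at
   least [c * e]. *)
have [zx|xz'] := ltP (z ord0 i) (Phi x ord0 i).
- pose y := x + v.
  have yk k : y ord0 k = x ord0 k + v ord0 k by rewrite mxE.
  have yx : y - x = v by rewrite /y addrC addKr.
  have yr : `|y - x| < r by rewrite yx; exact: le_lt_trans er.
  have [Yy yL] := H y x yr xx.
  have xy k : x ord0 k <= y ord0 k.
    by rewrite yk lerDl vE mulrn_wge0// ltW.
  have := xmin y Yy; apply/negP; rewrite -ltNge.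
  have := sum_Phi_decr KS KPM JM Yx Yy xy.
  have -> : \sum_(k < n) (y ord0 k - x ord0 k) = e.
    by rewrite -sumv; apply: eq_bigr => k _; rewrite yk addrC addKr.
  have : phi y <= phi x + \sum_(k < n) (Phi y ord0 k - Phi x ord0 k).
    rewrite /phi -big_split /=; apply: ler_sum => k _.
    have [->|ki] := eqVneq k i.
      have := le_coord_rV_norm (Phi y - Phi x) i.
      rewrite rV_coordB => /ler_normlP[? ?].
      move: eD; rewrite /D gtr0_norm ?subr_gt0// => eD.
      have := ler_wpM2l (ltW L0) vr; rewrite -yx => ?.
      by rewrite ger0_norm; lra.
    have := Phi_mono KS JM Yx Yy xy (k := k).
    rewrite yk vE (negbTE ki) mulr0n addr0 => /(_ erefl) ?.
    rewrite -[X in _ <= _ + X]ger0_norm ?subr_ge0//.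
    apply: le_trans (ler_normD _ _).
    by rewrite [X in _ <= `|X|]addrC addrA subrK.
  rewrite sumrB; have := mulr_gt0 c0 e0; lra.
(* In the mirror case node [i] moves left and the sum of [Phi] rises by at least [c * e]. *)
- have {xz xz'} xz : Phi x ord0 i < z ord0 i by rewrite lt_neqAle xz.
  pose y := x - v.
  have yk k : y ord0 k = x ord0 k - v ord0 k by rewrite rV_coordB.
  have yx : x - y = v by rewrite /y opprB addrC subrK.
  have yr : `|y - x| < r by rewrite distrC yx; exact: le_lt_trans er.
  have [Yy yL] := H y x yr xx.
  have xy k : y ord0 k <= x ord0 k.
    by rewrite yk gerBl vE mulrn_wge0// ltW.
  have := xmin y Yy; apply/negP; rewrite -ltNge.
  have := sum_Phi_decr KS KPM JM Yy Yx xy.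
  have -> : \sum_(k < n) (x ord0 k - y ord0 k) = e.
    by rewrite -sumv; apply: eq_bigr => k _; rewrite yk opprB addrC subrK.
  have : phi y <= phi x + \sum_(k < n) (Phi x ord0 k - Phi y ord0 k).
    rewrite /phi -big_split /=; apply: ler_sum => k _.
    have [->|ki] := eqVneq k i.
      have := le_coord_rV_norm (Phi y - Phi x) i.
      rewrite rV_coordB => /ler_normlP[? ?].
      move: eD; rewrite /D ltr0_norm ?subr_lt0// => eD.
      have := ler_wpM2l (ltW L0) vr; rewrite -yx [`|x - y|]distrC => ?.
      by rewrite ler0_norm; lra.
    have := Phi_mono KS JM Yy Yx xy (k := k).
    rewrite yk vE (negbTE ki) mulr0n subr0 => /(_ erefl) ?.
    rewrite -[X in _ <= _ + X]ger0_norm ?subr_ge0// [X in _ <= _ + X]distrC.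
    apply: le_trans (ler_normD _ _).
    by rewrite [X in _ <= `|X|]addrC addrA subrK.
  rewrite sumrB; have := mulr_gt0 c0 e0; lra.
Qed.
End Field.
End Surjectivity.

Theorem theorem2p1 (R : realType) (n : nat) (K : 'I_n -> R -> R)
  (J : R -> \bar R) (c : R) :
  0 < c ->
  (forall j : 'I_n, singular_kernel (K j) /\ PM c (K j)) ->
  n_field n J ->
  homeo_onto (regset K J) (Phi K J) /\ loc_biLipschitz (regset K J) (Phi K J).
Proof.
move=> c0 KH [[M JM] [s [us /allP Js ws]]].
have KS k := (KH k).1; have KPM k := (KH k).2.
have {}Js : {in s, forall t, 0 <= t <= 1 /\ J t != -oo%E}.
  by move=> t /Js /andP.
have inv := Phi_inv_lipschitz c0 KS KPM JM.
have loc y := @Phi_loc_lipschitz _ _ K J M KS JM y.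
split; last first.
  move=> y Yy; have [r [L [r0 L0 H]]] := loc y Yy.
  have nc : 0 <= n%:R / c by rewrite divr_ge0// ltW.
  (* The sum of the global inverse constant and the local constant serves both inequalities. *)
  exists r, (n%:R / c + L); split=> // [|a b Ya Yb ar br].
    exact: ltr_wpDl.
  rewrite !mulrDl; split.
    by apply: (le_trans (inv a b Ya Yb)); rewrite lerDl mulr_ge0// ltW.
  by apply: (le_trans (H a b ar br).2); rewrite lerDr mulr_ge0.
split.
  apply: continuous_in_subspaceT => y /set_mem Yy.
  have [r [L [r0 _ H]]] := loc y Yy.
  apply: (lipschitz_at_continuous (L := L) r0) => a ar.
  by apply: (H a y ar _).2; rewrite subrr normr0.
have /choice[g gP] z : exists y, regset K J y /\ Phi K J y = z.
  by have [y Yy yz] := Phi_surj c0 KS KPM JM us Js ws z; exists y.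
exists g; split => // [y Yy|z].
  have [Yg Eg] := gP (Phi K J y); apply/eqP.
  rewrite -subr_eq0 -normr_eq0 eq_le normr_ge0 andbT.
  by apply: (le_trans (inv _ _ Yg Yy)); rewrite Eg subrr normr0 mulr0.
(* The inverse is globally Lipschitz, so any radius works; 1 is taken. *)
apply: (lipschitz_at_continuous (L := n%:R / c) ltr01) => a _.
have [[Ya Ea] [Yz Ez]] := (gP a, gP z).
by rewrite -{2}Ea -{2}Ez; exact: inv.
Qed.
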